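(* Let $\Omega=(x_W,x_E)\times(y_S,y_N)$, with $\phi$, $\beta$ and the grid as in the context, and let $a,b,g,f\in C^1(\overline\Omega)$ with $a,b$ vanishing on $\partial\Omega$. Let $u^h\in H^{1,h}$ be a grid function such that $v^h=u^h-g^h+a^h\chi^h$ lies in $H^{1,h}_0$, where $(a^h\chi^h)_{i,j}=a_{i,j}\chi_{i,j}$. Then $v^h$ satisfies the discrete weak problem $$-B^h[v^h,\psi^h]=F^h(\psi^h)\quad\text{for all }\psi^h\in H^{1,h}_0$$ if and only if $u^h$ satisfies the finite difference scheme $$\nabla_x(\beta^1\nabla_xu)_{i,j}+\nabla_y(\beta^2\nabla_yu)_{i,j}=-\nabla_x(\beta^1a^1\nabla_x\chi)_{i,j}-\nabla_y(\beta^2a^2\nabla_y\chi)_{i,j}-b_{i,j}\bigl[n^{(1)}_{i,j}(\nabla_x\chi^1)_{i,j}+n^{(2)}_{i,j}(\nabla_y\chi^2)_{i,j}\bigr]+f_{i,j}$$ at all interior grid points $(x_i,y_j)$, $1\le i\le I$, $1\le j\le J$.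
   Context: **Setting.** $\Omega=(x_W,x_E)\times(y_S,y_N)$. $\phi$ is a smooth real function on $\overline\Omega$ with $\Omega^-=\{\phi<0\}$, $\Omega^+=\{\phi>0\}$, $\Gamma=\{\phi=0\}\subset\Omega$ a smooth curve with $\partial\Omega^-=\Gamma$, $\phi$ being the signed distance to $\Gamma$ near $\Gamma$. $\beta$ is a scalar function with $0<m\le\beta\le M$, $C^1$ on the closure of each of $\Omega^\pm$, taking on $\Gamma$ the limiting values from $\Omega^-$. **Grid.** For positive integers $I,J$, $\Delta x=(x_E-x_W)/(I+1)$, $\Delta y=(y_N-y_S)/(J+1)$, $x_i=x_W+i\Delta x$, $y_j=y_S+j\Delta y$ (also for half-integer indices), $h=\min(\Delta x,\Delta y)$. $H^{1,h}$ is the space of real grid functions $(w_{i,j})$, $0\le i\le I+1$, $0\le j\le J+1$; $H^{1,h}_0$ is the subspace of those vanishing on the grid boundary. $a_{i,j}=a(x_i,y_j)$, and similarly for $b,g,f,\phi$ (giving $a^h$, $g^h$, etc.). **Difference operators.** $(\nabla_xw)_{i+1/2,j}=(w_{i+1,j}-w_{i,j})/\Delta x$, $(\nabla_yw)_{i,j+1/2}=(w_{i,j+1}-w_{i,j})/\Delta y$ for grid functions; for functions at half grid points, $(\nabla_x\alpha)_{i,j}=(\alpha_{i+1/2,j}-\alpha_{i-1/2,j})/\Delta x$, $(\nabla_y\alpha)_{i,j}=(\alpha_{i,j+1/2}-\alpha_{i,j-1/2})/\Delta y$. Products such as $\beta^1\nabla_xu$ are pointwise at half grid points. $\beta^1_{i+1/2,j}=\beta(x_{i+1/2},y_j)$,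 $\beta^2_{i,j+1/2}=\beta(x_i,y_{j+1/2})$. **Discrete normal.** At interior grid points, $n_{i,j}=(n^{(1)}_{i,j},n^{(2)}_{i,j})$ is the vector $\bigl((\phi_{i+1,j}-\phi_{i-1,j})/(2\Delta x),(\phi_{i,j+1}-\phi_{i,j-1})/(2\Delta y)\bigr)$ divided by its Euclidean length (set to $0$ if it vanishes). Products $(bn^{(k)}\psi)_{i,j}$ are $0$ at boundary grid points. **Characteristic functions.** $\chi_{i,j}=1$ if $\phi_{i,j}\le0$, $0$ if $\phi_{i,j}>0$. $\theta_{i+1/2,j}=|\phi_{i+1,j}|/(|\phi_{i,j}|+|\phi_{i+1,j}|)$ if the denominator is positive, $0$ otherwise; $\theta_{i,j+1/2}=|\phi_{i,j+1}|/(|\phi_{i,j}|+|\phi_{i,j+1}|)$ if the denominator is positive, $0$ otherwise. $\chi^1_{i+1/2,j}=\chi_{i,j}(1-\theta_{i+1/2,j})+\chi_{i+1,j}\theta_{i+1/2,j}$, $\chi^2_{i,j+1/2}=\chi_{i,j}(1-\theta_{i,j+1/2})+\chi_{i,j+1}\theta_{i,j+1/2}$. Averages of $a$: $a^1_{i+1/2,j}=a_{i+1,j}(1-\theta_{i+1/2,j})+a_{i,j}\theta_{i+1/2,j}$, $a^2_{i,j+1/2}=a_{i,j+1}(1-\theta_{i,j+1/2})+a_{i,j}\theta_{i,j+1/2}$. **Forms.** For $v^h\in H^{1,h}$, $\psi^h\in H^{1,h}_0$, $$B^h[v^h,\psi^h]=\sum_{j=1}^J\sum_{i=0}^I\beta^1_{i+1/2,j}(\nabla_xv)_{i+1/2,j}(\nabla_x\psi)_{i+1/2,j}\Delta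 x\Delta y+\sum_{i=1}^I\sum_{j=0}^J\beta^2_{i,j+1/2}(\nabla_yv)_{i,j+1/2}(\nabla_y\psi)_{i,j+1/2}\Delta x\Delta y.$$ $F^h=F^h_1+F^h_2+F^h_3+F^h_4$, where $F^h_1(\psi^h)=\sum_{i=1}^I\sum_{j=1}^Jf_{i,j}\psi_{i,j}\Delta x\Delta y$, $F^h_2(\psi^h)=B^h[g^h,\psi^h]$, $$F^h_3(\psi^h)=-\sum_{j=1}^J\sum_{i=0}^I\beta^1_{i+1/2,j}(\nabla_xa)_{i+1/2,j}(\nabla_x\psi)_{i+1/2,j}\chi^1_{i+1/2,j}\Delta x\Delta y-\sum_{i=1}^I\sum_{j=0}^J\beta^2_{i,j+1/2}(\nabla_ya)_{i,j+1/2}(\nabla_y\psi)_{i,j+1/2}\chi^2_{i,j+1/2}\Delta x\Delta y,$$ $$F^h_4(\psi^h)=\sum_{j=1}^J\sum_{i=0}^I\nabla_x(bn^{(1)}\psi)_{i+1/2,j}\chi^1_{i+1/2,j}\Delta x\Delta y+\sum_{i=1}^I\sum_{j=0}^J\nabla_y(bn^{(2)}\psi)_{i,j+1/2}\chi^2_{i,j+1/2}\Delta x\Delta y.$$ *)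

(* Defs.v *)
From HB Require Import structures.
From mathcomp Require Import all_boot all_order all_algebra.
From mathcomp Require Import all_classical all_reals all_analysis.
Import Order.TTheory GRing.Theory Num.Theory.
Import numFieldNormedType.Exports.
Local Open Scope classical_set_scope.
Local Open Scope ring_scope.

Definition bd {T : topologicalType} (A : set T) : set T :=
  closure A `\` interior A.

(* f is C^k on the closure of the open set U: f is continuous on closure U and,
   for k > 0, its partial derivatives on U exist and extend to functions that
   are C^(k-1) on closure U. *)
Fixpoint Ck {R : realType} (k : nat) (U : set (R * R)) (f : R * R -> R) : Prop :=
  {within closure U, continuous f} /\
  match k with
  | 0%N => True
  | k'.+1 => exists fx fy : R * R -> R,
      [/\ forall p, U p -> is_derive p ((1, 0) : R * R) f (fx p),
          forall p, U p -> is_derive p ((0, 1) : R * R) f (fy p),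
          Ck k' U fx
        & Ck k' U fy]
  end.

Definition smooth_on_closure {R : realType} (U : set (R * R)) (f : R * R -> R) :=
  forall k, Ck k U f.

(* Nonempty one-dimensional embedded smooth submanifold of the plane, i.e.
   locally the graph of a smooth function of one of the two coordinates.
   (ball p e is an open square; shrinking it, the local graph function can
   always be taken smooth on the whole line.) *)
Definition smooth_curve {R : realType} (C : set (R * R)) : Prop :=
  C !=set0 /\
  forall p, C p -> exists e : R, 0 < e /\ exists h : R -> R,
    (forall (n : nat) (x : R), derivable (derive1n n h) x 1) /\
    ((forall q, ball p e q -> (C q <-> q.2 = h q.1)) \/
     (forall q, ball p e q -> (C q <-> q.1 = h q.2))).

(* The library norm on R * R is the sup norm, so the Euclidean distance is
   written out. *)
Definition eucl_dist {R : realType} (p q : R * R) : R :=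
  Num.sqrt ((p.1 - q.1) ^+ 2 + (p.2 - q.2) ^+ 2).

Definition set_dist {R : realType} (C : set (R * R)) (p : R * R) : R :=
  inf [set eucl_dist p q | q in C].

(* Signed distance to C, negative in A. *)
Definition signed_dist {R : realType} (A C : set (R * R)) (p : R * R) : R :=
  if p \in A then - set_dist C p else set_dist C p.

Record grid (R : realType) := Grid {
  xW : R; xE : R; yS : R; yN : R;
  nI : nat; nJ : nat }.
Arguments Grid {R}.
Arguments xW {R}. Arguments xE {R}. Arguments yS {R}. Arguments yN {R}.
Arguments nI {R}. Arguments nJ {R}.

Section Domain.
Context {R : realType} (G : grid R).

Definition Omega : set (R * R) :=
  [set p | xW G < p.1 < xE G /\ yS G < p.2 < yN G].

Definition Omega_minus (phi : R * R -> R) : set (R * R) :=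
  [set p | Omega p /\ phi p < 0].

Definition Omega_plus (phi : R * R -> R) : set (R * R) :=
  [set p | Omega p /\ 0 < phi p].

Definition Gamma (phi : R * R -> R) : set (R * R) :=
  [set p | closure Omega p /\ phi p = 0].

End Domain.

Section Scheme.
Context {R : realType} (G : grid R).

Definition Dx : R := (xE G - xW G) / (nI G).+1%:R.
Definition Dy : R := (yN G - yS G) / (nJ G).+1%:R.
Definition xg (i : nat) : R := xW G + i%:R * Dx.
Definition yg (j : nat) : R := yS G + j%:R * Dy.
Definition xh (i : nat) : R := xW G + (i%:R + 2^-1) * Dx.
Definition yh (j : nat) : R := yS G + (j%:R + 2^-1) * Dy.

(* H^{1,h}: real grid functions, indexed by 0 <= i <= I+1, 0 <= j <= J+1. *)
Definition H1 : Type := 'M[R]_((nI G).+2, (nJ G).+2).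

(* w_{i,j} for natural number indices (only used with i <= I+1, j <= J+1). *)
Definition gv (w : H1) (i j : nat) : R := w (inord i) (inord j).

Definition interior_index (i j : nat) : bool :=
  (0 < i <= nI G)%N && (0 < j <= nJ G)%N.

Definition H10 (w : H1) : Prop :=
  forall (i : 'I_(nI G).+2) (j : 'I_(nJ G).+2),
    ~~ interior_index i j -> w i j = 0.

Definition sample (f : R * R -> R) : H1 := \matrix_(i, j) f (xg i, yg j).

(* Functions at half grid points have type nat -> nat -> R: the value at
   (i+1/2, j) (for d/dx) or at (i, j+1/2) (for d/dy) is stored at i, j. *)
Definition gradx (w : H1) (i j : nat) : R := (gv w i.+1 j - gv w i j) / Dx.
Definition grady (w : H1) (i j : nat) : R := (gv w i j.+1 - gv w i j) / Dy.

(* Differences of half grid functions at the grid point (i, j), i, j >= 1. *)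
Definition divx (al : nat -> nat -> R) (i j : nat) : R :=
  (al i j - al i.-1 j) / Dx.
Definition divy (al : nat -> nat -> R) (i j : nat) : R :=
  (al i j - al i j.-1) / Dy.

Definition beta1 (beta : R * R -> R) (i j : nat) : R := beta (xh i, yg j).
Definition beta2 (beta : R * R -> R) (i j : nat) : R := beta (xg i, yh j).

Section LevelSet.
Variable phi : R * R -> R.
Let ph := gv (sample phi).

(* In normal1, normal2, theta1 and theta2 the prescribed value 0 for a
   vanishing denominator is x / 0 = 0. *)
Definition cdx (i j : nat) : R := (ph i.+1 j - ph i.-1 j) / (2 * Dx).
Definition cdy (i j : nat) : R := (ph i j.+1 - ph i j.-1) / (2 * Dy).
Definition normal1 (i j : nat) : R :=
  cdx i j / Num.sqrt (cdx i j ^+ 2 + cdy i j ^+ 2).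
Definition normal2 (i j : nat) : R :=
  cdy i j / Num.sqrt (cdx i j ^+ 2 + cdy i j ^+ 2).

Definition chi : H1 := \matrix_(i, j) (if phi (xg i, yg j) <= 0 then 1 else 0).

Definition theta1 (i j : nat) : R :=
  `|ph i.+1 j| / (`|ph i j| + `|ph i.+1 j|).
Definition theta2 (i j : nat) : R :=
  `|ph i j.+1| / (`|ph i j| + `|ph i j.+1|).

Definition chi1 (i j : nat) : R :=
  gv chi i j * (1 - theta1 i j) + gv chi i.+1 j * theta1 i j.
Definition chi2 (i j : nat) : R :=
  gv chi i j * (1 - theta2 i j) + gv chi i j.+1 * theta2 i j.

(* In contrast with chi1 and chi2, the weights are exchanged. *)
Definition avg1 (w : H1) (i j : nat) : R :=
  gv w i.+1 j * (1 - theta1 i j) + gv w i j * theta1 i j.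
Definition avg2 (w : H1) (i j : nat) : R :=
  gv w i j.+1 * (1 - theta2 i j) + gv w i j * theta2 i j.

(* The grid functions b n^(k) psi, zero at boundary grid points. *)
Definition bnpsi1 (b : R * R -> R) (psi : H1) : H1 :=
  \matrix_(i, j) (if interior_index i j
                  then b (xg i, yg j) * normal1 i j * psi i j else 0).
Definition bnpsi2 (b : R * R -> R) (psi : H1) : H1 :=
  \matrix_(i, j) (if interior_index i j
                  then b (xg i, yg j) * normal2 i j * psi i j else 0).

End LevelSet.

Definition Bh (beta : R * R -> R) (v psi : H1) : R :=
  \sum_(1 <= j < (nJ G).+1) \sum_(0 <= i < (nI G).+1)
     beta1 beta i j * gradx v i j * gradx psi i j * Dx * Dy +
  \sum_(1 <= i < (nI G).+1) \sum_(0 <= j < (nJ G).+1)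
     beta2 beta i j * grady v i j * grady psi i j * Dx * Dy.

Definition Fh1 (f : R * R -> R) (psi : H1) : R :=
  \sum_(1 <= i < (nI G).+1) \sum_(1 <= j < (nJ G).+1)
     gv (sample f) i j * gv psi i j * Dx * Dy.

Definition Fh2 (beta g : R * R -> R) (psi : H1) : R := Bh beta (sample g) psi.

Definition Fh3 (phi beta a : R * R -> R) (psi : H1) : R :=
  - (\sum_(1 <= j < (nJ G).+1) \sum_(0 <= i < (nI G).+1)
       beta1 beta i j * gradx (sample a) i j * gradx psi i j
         * chi1 phi i j * Dx * Dy)
  - (\sum_(1 <= i < (nI G).+1) \sum_(0 <= j < (nJ G).+1)
       beta2 beta i j * grady (sample a) i j * grady psi i j
         * chi2 phi i j * Dx * Dy).

Definition Fh4 (phi b : R * R -> R) (psi : H1) : R :=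
  \sum_(1 <= j < (nJ G).+1) \sum_(0 <= i < (nI G).+1)
     gradx (bnpsi1 phi b psi) i j * chi1 phi i j * Dx * Dy +
  \sum_(1 <= i < (nI G).+1) \sum_(0 <= j < (nJ G).+1)
     grady (bnpsi2 phi b psi) i j * chi2 phi i j * Dx * Dy.

Definition Fh (phi beta a b g f : R * R -> R) (psi : H1) : R :=
  Fh1 f psi + Fh2 beta g psi + Fh3 phi beta a psi + Fh4 phi b psi.

(* u - g^h + a^h chi^h, with a^h chi^h the entrywise product. *)
Definition shifted (phi a g : R * R -> R) (u : H1) : H1 :=
  \matrix_(i, j) (u i j - sample g i j + sample a i j * chi phi i j).

Definition discrete_weak (phi beta a b g f : R * R -> R) (v : H1) : Prop :=
  forall psi : H1, H10 psi -> - Bh beta v psi = Fh phi beta a b g f psi.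

Definition fd_scheme (phi beta a b f : R * R -> R) (u : H1) : Prop :=
  forall i j : nat, (1 <= i <= nI G)%N -> (1 <= j <= nJ G)%N ->
    divx (fun k l => beta1 beta k l * gradx u k l) i j
    + divy (fun k l => beta2 beta k l * grady u k l) i j
    = - divx (fun k l => beta1 beta k l * avg1 phi (sample a) k l
                           * gradx (chi phi) k l) i j
      - divy (fun k l => beta2 beta k l * avg2 phi (sample a) k l
                           * grady (chi phi) k l) i j
      - gv (sample b) i j * (normal1 phi i j * divx (chi1 phi) i j
                             + normal2 phi i j * divy (chi2 phi) i j)
      + gv (sample f) i j.

End Scheme.

(* Main.v *)
Require Import Defs.
From HB Require Import structures.
From mathcomp Require Import all_boot all_order all_algebra.
From mathcomp Require Import all_classical all_reals all_analysis.
From mathcomp Require Import ring.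
Import Order.TTheory GRing.Theory Num.Theory.
Import numFieldNormedType.Exports.
Local Open Scope classical_set_scope.
Local Open Scope ring_scope.

(* Summation by parts turns every term of the weak problem into an L2 pairing
   with psi.  Because a^1 and chi^1 carry exchanged weights, the discrete
   product rule grad (a chi) = a^1 grad chi + chi^1 grad a is exact, so
   - B^h[v, psi] - F^h(psi) is the pairing of psi with the residual of the
   scheme; point masses psi then recover the scheme at each grid point. *)

(** Abel summation by induction on [n]. The boundary terms are kept; they drop out once [w] comes
    from a function in [H10]. The right-hand sum starts at 1, so [i.-1] is a genuine predecessor. *)
Lemma summation_by_parts (A : comPzRingType) (al w : nat -> A) (n : nat) :
  \sum_(0 <= i < n.+1) al i * (w i.+1 - w i) =
  al n * w n.+1 - al 0 * w 0
  - \sum_(1 <= i < n.+1) (al i - al i.-1) * w i.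
Proof.
elim: n => [|n IHn]; first by rewrite big_nat1 big_geq // subr0 mulrBr.
by rewrite big_nat_recr //= IHn [in RHS]big_nat_recr //=; ring.
Qed.

(** * The discrete L2 pairing over interior grid points *)

Section GridPairing.
Context {R : realType} (G : grid R).
Implicit Types (al F : nat -> nat -> R) (u v w psi : H1 G).

(** Sums and factors are in the order of [Fh1], so that [Fh1] is a pairing by conversion. *)
Definition pairing F psi : R :=
  \sum_(1 <= i < (nI G).+1) \sum_(1 <= j < (nJ G).+1)
     F i j * gv G psi i j * Dx G * Dy G.

Lemma pairingD F1 F2 psi :
  pairing F1 psi + pairing F2 psi = pairing (fun i j => F1 i j + F2 i j) psi.
Proof.
rewrite -big_split; apply: eq_bigr => i _ /=.
by rewrite -big_split; apply: eq_bigr => j _ /=; rewrite !mulrDl.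
Qed.

Lemma pairingN F psi : - pairing F psi = pairing (fun i j => - F i j) psi.
Proof.
rewrite -sumrN; apply: eq_bigr => i _; rewrite -sumrN.
by apply: eq_bigr => j _; rewrite !mulNr.
Qed.

Lemma eq_pairing F1 F2 psi :
    (forall i j, (1 <= i <= nI G)%N -> (1 <= j <= nJ G)%N ->
       F1 i j * gv G psi i j = F2 i j * gv G psi i j) ->
  pairing F1 psi = pairing F2 psi.
Proof.
move=> eqF; apply: eq_big_nat => i Hi; apply: eq_big_nat => j Hj.
by rewrite eqF.
Qed.

Lemma gv_boundary psi i j : H10 G psi -> (i <= (nI G).+1)%N ->
  (j <= (nJ G).+1)%N -> ~~ interior_index G i j -> gv G psi i j = 0.
Proof. by move=> psi0 Hi Hj Hij; apply: psi0; rewrite !inordK. Qed.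

Definition point_mass (i j : nat) : H1 G := delta_mx (inord i) (inord j).

(** The bounds exclude the default of [inord], which sends every out-of-range index to 0 and would
    identify distinct indices. *)
Lemma gv_point_mass i j k l : (i <= (nI G).+1)%N -> (j <= (nJ G).+1)%N ->
  (k <= (nI G).+1)%N -> (l <= (nJ G).+1)%N ->
  gv G (point_mass i j) k l = ((k == i) && (l == j))%:R.
Proof. by move=> Hi Hj Hk Hl; rewrite /gv mxE -!val_eqE /= !inordK. Qed.

Lemma point_mass_H10 i j : interior_index G i j -> H10 G (point_mass i j).
Proof.
move=> Hij k l Hkl; rewrite mxE; case: andP => // -[/eqP kE /eqP lE].
case/andP: (Hij) => /andP[_ Hi] /andP[_ Hj].
by move: Hkl; rewrite kE lE !inordK ?Hij // ltnS ltnW.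
Qed.

Lemma pairing_point_mass F i j : interior_index G i j ->
  pairing F (point_mass i j) = F i j * Dx G * Dy G.
Proof.
case/andP => /andP[i0 Hi] /andP[j0 Hj].
have pmE k l : (1 <= k < (nI G).+1)%N -> (1 <= l < (nJ G).+1)%N ->
    gv G (point_mass i j) k l = ((k == i) && (l == j))%:R.
  by move=> /andP[_ Hk] /andP[_ Hl]; rewrite gv_point_mass // ltnW.
(* Splitting off row [i], then its entry [j], leaves two remainders on which the point mass
   vanishes: the other rows, and the rest of row [i]. *)
rewrite /pairing (bigD1_seq i) ?mem_index_iota ?iota_uniq ?i0 //=.
rewrite (bigD1_seq j) ?mem_index_iota ?iota_uniq ?j0 //=.
rewrite pmE ?i0 ?j0 // !eqxx mulr1 !big1_seq ?addr0 //.
- move=> k /andP[/negPf ki]; rewrite mem_index_iota => Hk.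
  rewrite big1_seq // => l /andP[_]; rewrite mem_index_iota => Hl.
  by rewrite pmE // ki mulr0 !mul0r.
- move=> l /andP[/negPf lj]; rewrite mem_index_iota => Hl.
  by rewrite pmE ?i0 // lj andbF mulr0 !mul0r.
Qed.

(** * Summation by parts on the grid, in each direction *)

Lemma sum_gradx_by_parts al w : H10 G w ->
  \sum_(1 <= j < (nJ G).+1) \sum_(0 <= i < (nI G).+1)
     al i j * gradx G w i j * Dx G * Dy G = - pairing (divx G al) w.
Proof.
move=> w0; rewrite /pairing [in RHS]exchange_big_nat -sumrN.
apply: eq_big_nat => j /andP[_ Hj].
(* The quotient [Dx G / Dx G] is left uncancelled, because [divx] produces the same one on the other
   side. *)
transitivity (Dy G * Dx G / Dx G * \sum_(0 <= i < (nI G).+1)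
    al i j * (gv G w i.+1 j - gv G w i j)).
  by rewrite mulr_sumr; apply: eq_bigr => i _; rewrite /gradx; ring.
(* Both boundary terms vanish: they evaluate [w] at the indices 0 and I+1. *)
rewrite (summation_by_parts _ (al^~ j) (gv G w ^~ j)).
rewrite !gv_boundary ?(ltnW Hj) // /interior_index ?ltnn ?andbF //.
rewrite !mulr0 subr0 sub0r mulrN mulr_sumr; congr (- _).
by apply: eq_bigr => i _; rewrite /divx; ring.
Qed.

Lemma sum_grady_by_parts al w : H10 G w ->
  \sum_(1 <= i < (nI G).+1) \sum_(0 <= j < (nJ G).+1)
     al i j * grady G w i j * Dx G * Dy G = - pairing (divy G al) w.
Proof.
move=> w0; rewrite /pairing -sumrN.
apply: eq_big_nat => i /andP[_ Hi].
transitivity (Dx G * Dy G / Dy G * \sum_(0 <= j < (nJ G).+1)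
    al i j * (gv G w i j.+1 - gv G w i j)).
  by rewrite mulr_sumr; apply: eq_bigr => j _; rewrite /grady; ring.
rewrite (summation_by_parts _ (al i) (gv G w i)).
rewrite !gv_boundary ?(ltnW Hi) // /interior_index ?ltnn ?andbF //.
rewrite !mulr0 subr0 sub0r mulrN mulr_sumr; congr (- _).
by apply: eq_bigr => j _; rewrite /divy; ring.
Qed.

(** * The forms of the weak problem as pairings with [psi] *)

Lemma Bh_pairing beta v psi : H10 G psi ->
  Bh G beta v psi =
  - pairing (fun i j =>
      divx G (fun k l => beta1 G beta k l * gradx G v k l) i j
      + divy G (fun k l => beta2 G beta k l * grady G v k l) i j) psi.
Proof.
move=> psi0; rewrite /Bh (sum_gradx_by_parts (fun k l => _ * _)) //.
by rewrite (sum_grady_by_parts (fun k l => _ * _)) // -opprD pairingD.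
Qed.

Variable phi : R * R -> R.

Lemma Fh3_pairing beta a psi : H10 G psi ->
  Fh3 G phi beta a psi =
  pairing (fun i j =>
    divx G (fun k l => beta1 G beta k l * gradx G (sample G a) k l
                         * chi1 G phi k l) i j
    + divy G (fun k l => beta2 G beta k l * grady G (sample G a) k l
                         * chi2 G phi k l) i j) psi.
Proof.
(* Double negations expose the negated pairings, so that summation by parts can be read from right
   to left. *)
move=> psi0; rewrite -pairingD -[X in X + _]opprK -[X in _ = _ + X]opprK.
rewrite -sum_gradx_by_parts // -sum_grady_by_parts // /Fh3.
by congr (- _ - _); apply: eq_bigr => i _; apply: eq_bigr => j _; ring.
Qed.

Lemma bnpsi1_H10 b psi : H10 G (bnpsi1 G phi b psi).
Proof. by move=> i j /negPf Hij; rewrite mxE Hij. Qed.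

Lemma bnpsi2_H10 b psi : H10 G (bnpsi2 G phi b psi).
Proof. by move=> i j /negPf Hij; rewrite mxE Hij. Qed.

Lemma gv_bnpsi1 b psi i j : interior_index G i j ->
  gv G (bnpsi1 G phi b psi) i j
  = gv G (sample G b) i j * normal1 G phi i j * gv G psi i j.
Proof.
move=> Hij; case/andP: (Hij) => /andP[_ Hi] /andP[_ Hj].
by rewrite /gv !mxE !inordK ?Hij // ltnS ltnW.
Qed.

Lemma gv_bnpsi2 b psi i j : interior_index G i j ->
  gv G (bnpsi2 G phi b psi) i j
  = gv G (sample G b) i j * normal2 G phi i j * gv G psi i j.
Proof.
move=> Hij; case/andP: (Hij) => /andP[_ Hi] /andP[_ Hj].
by rewrite /gv !mxE !inordK ?Hij // ltnS ltnW.
Qed.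

(** Here summation by parts acts on [bnpsi1] and [bnpsi2], which vanish on the grid boundary by
    construction whatever [psi] is. The difference moves onto [chi1] and [chi2], and at interior
    points the factors b and n separate from [psi]. *)
Lemma Fh4_pairing b psi :
  Fh4 G phi b psi =
  - pairing (fun i j => gv G (sample G b) i j
      * (normal1 G phi i j * divx G (chi1 G phi) i j
         + normal2 G phi i j * divy G (chi2 G phi) i j)) psi.
Proof.
transitivity (- pairing (divx G (chi1 G phi)) (bnpsi1 G phi b psi)
              - pairing (divy G (chi2 G phi)) (bnpsi2 G phi b psi)).
  rewrite -sum_gradx_by_parts; last exact: bnpsi1_H10.
  rewrite -sum_grady_by_parts; last exact: bnpsi2_H10.
  by congr (_ + _); apply: eq_bigr => i _; apply: eq_bigr => j _; ring.
rewrite -opprD; congr (- _); rewrite /pairing -big_split.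
apply: eq_big_nat => i Hi /=; rewrite -big_split.
apply: eq_big_nat => j Hj /=.
have Hij : interior_index G i j by exact/andP.
by rewrite gv_bnpsi1 // gv_bnpsi2 //; ring.
Qed.

(** * The product rule for the shifted unknown, and the residual *)

Lemma gv_shifted a g u i j :
  gv G (shifted G phi a g u) i j =
  gv G u i j - gv G (sample G g) i j
  + gv G (sample G a) i j * gv G (chi G phi) i j.
Proof. by rewrite /gv [LHS]mxE. Qed.

(** The difference of a chi obeys two one-sided product rules; averaging them with weights 1 - theta
    and theta gives [avg1] and [chi1]. This is valid for every theta, including the default 0 where
    phi vanishes at both ends. *)
Lemma gradx_shifted a g u i j :
  gradx G (shifted G phi a g u) i j =
  gradx G u i j - gradx G (sample G g) i j
  + avg1 G phi (sample G a) i j * gradx G (chi G phi) i j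
  + gradx G (sample G a) i j * chi1 G phi i j.
Proof. by rewrite /gradx !gv_shifted /avg1 /chi1; ring. Qed.

Lemma grady_shifted a g u i j :
  grady G (shifted G phi a g u) i j =
  grady G u i j - grady G (sample G g) i j
  + avg2 G phi (sample G a) i j * grady G (chi G phi) i j
  + grady G (sample G a) i j * chi2 G phi i j.
Proof. by rewrite /grady !gv_shifted /avg2 /chi2; ring. Qed.

(** The two sides of [fd_scheme] are copied verbatim, so that [subr_eq0] passes between the scheme
    and a vanishing residual. *)
Definition residual (beta a b f : R * R -> R) u (i j : nat) : R :=
  divx G (fun k l => beta1 G beta k l * gradx G u k l) i j
  + divy G (fun k l => beta2 G beta k l * grady G u k l) i j
  - (- divx G (fun k l => beta1 G beta k l * avg1 G phi (sample G a) k l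
                         * gradx G (chi G phi) k l) i j
     - divy G (fun k l => beta2 G beta k l * avg2 G phi (sample G a) k l
                         * grady G (chi G phi) k l) i j
     - gv G (sample G b) i j * (normal1 G phi i j * divx G (chi1 G phi) i j
                              + normal2 G phi i j * divy G (chi2 G phi) i j)
     + gv G (sample G f) i j).

Lemma weak_residual beta a b g f u psi : H10 G psi ->
  - Bh G beta (shifted G phi a g u) psi - Fh G phi beta a b g f psi =
  pairing (residual beta a b f u) psi.
Proof.
move=> psi0; rewrite /Fh /Fh2 !Bh_pairing // Fh3_pairing // Fh4_pairing.
rewrite -[Fh1 _ _ _]/(pairing _ _) !(pairingN, pairingD).
apply: eq_pairing => i j _ _; congr (_ * _).
(* The g terms cancel against [Fh2], and the terms chi^k grad a against [Fh3]. *)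
by rewrite /residual /divx /divy !gradx_shifted !grady_shifted; ring.
Qed.

End GridPairing.

Theorem mainTheorem5 (R : realType) (G : grid R)
  (hx : xW G < xE G) (hy : yS G < yN G)
  (hI : (0 < nI G)%N) (hJ : (0 < nJ G)%N)
  (phi beta a b g f : R * R -> R) (m M : R)
  (phi_smooth : smooth_on_closure (Omega G) phi)
  (Gamma_sub : Gamma G phi `<=` Omega G)
  (Gamma_curve : smooth_curve (Gamma G phi))
  (bd_minus : bd (Omega_minus G phi) = Gamma G phi)
  (phi_dist : exists V : set (R * R),
     [/\ open V, Gamma G phi `<=` V
       & forall p, V p -> closure (Omega G) p ->
           phi p = signed_dist (Omega_minus G phi) (Gamma G phi) p])
  (m_gt0 : 0 < m)
  (beta_bounds : forall p, closure (Omega G) p -> m <= beta p <= M)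
  (beta_minus : Ck 1 (Omega_minus G phi) beta)
  (beta_plus : exists2 betap : R * R -> R, Ck 1 (Omega_plus G phi) betap
     & forall p, closure (Omega_plus G phi) p -> ~ Gamma G phi p ->
         betap p = beta p)
  (a_C1 : Ck 1 (Omega G) a) (b_C1 : Ck 1 (Omega G) b)
  (g_C1 : Ck 1 (Omega G) g) (f_C1 : Ck 1 (Omega G) f)
  (a_bd : forall p, bd (Omega G) p -> a p = 0)
  (b_bd : forall p, bd (Omega G) p -> b p = 0)
  (u : H1 G) (hv : H10 G (shifted G phi a g u)) :
  discrete_weak G phi beta a b g f (shifted G phi a g u)
  <-> fd_scheme G phi beta a b f u.
Proof.
have Dx_neq0 : Dx G != 0.
  by rewrite mulf_neq0 ?invr_eq0 ?pnatr_eq0 // subr_eq0 gt_eqF.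
have Dy_neq0 : Dy G != 0.
  by rewrite mulf_neq0 ?invr_eq0 ?pnatr_eq0 // subr_eq0 gt_eqF.
split=> [weak i j Hi Hj | scheme psi psi0]; apply/eqP; rewrite -subr_eq0.
- have Hij : interior_index G i j by exact/andP.
  have := weak_residual G phi beta a b g f u _ (point_mass_H10 G i j Hij).
  rewrite weak; last exact: point_mass_H10.
  rewrite subrr pairing_point_mass // => /esym res0; apply/eqP.
  (* The point mass gives the residual times the cell area, which is nonzero since both sides of the
     rectangle have positive length. *)
  by apply: (mulIf Dx_neq0); apply: (mulIf Dy_neq0); rewrite !mul0r.
- rewrite weak_residual //; apply/eqP.
  (* The pairing visits only interior points, exactly where the scheme holds. *)
  rewrite /pairing big_nat big1 // => i Hi; rewrite big_nat big1 // => j Hj.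
  by rewrite /residual scheme // subrr !mul0r.
Qed.
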